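(* Let $G_1$ be a finite, simple, connected, non-complete graph and let $G_2$ be a finite simple graph. If $k_1(G_1)=k(G_1)$, then $k_1(G_1\circ G_2)=k(G_1\circ G_2)$.
   Context: All graphs are finite, simple and undirected. For a graph $G$, a set $S\subseteq V(G)$ is a vertex-cut of $G$ if $G-S$ is disconnected or $G-S$ is the trivial graph $K_1$. The connectivity $k(G)$ is the minimum cardinality of a vertex-cut of $G$. A vertex-cut $S$ of $G$ is a $k_1$-vertex-cut if $G-S$ has no isolated vertices; the $k_1$-connectivity $k_1(G)$ is the minimum cardinality of a $k_1$-vertex-cut of $G$, with $k_1(G)=\infty$ if no $k_1$-vertex-cut exists. The lexicographic product $G_1\circ G_2$ has vertex set $V(G_1)\times V(G_2)$, where $(x_1,y_1)$ and $(x_2,y_2)$ are adjacent if and only if either $x_1x_2\in E(G_1)$, or $x_1=x_2$ and $y_1y_2\in E(G_2)$. *)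

(* Defs.v *)
From mathcomp Require Import all_boot.

Set Implicit Arguments.
Unset Strict Implicit.
Unset Printing Implicit Defensive.

Record sgraph := SGraph {
  vertex :> finType;
  adj : rel vertex;
  adj_sym : symmetric adj;
  adj_irr : irreflexive adj }.

Definition complete (G : sgraph) : bool :=
  [forall x : G, forall y : G, (x != y) ==> adj x y].

(* The graph without vertices is connected in this sense, so deleting all the
   vertices of a graph does not count as disconnecting it. *)
Definition connected (G : sgraph) : bool :=
  [forall x : G, forall y : G, connect (@adj G) x y].

Definition isolated (G : sgraph) (x : G) : bool :=
  [forall y : G, ~~ adj x y].

Section DeleteVertices.
Variables (G : sgraph) (S : {set G}).

Definition delete_vertex : finType := {x : G | x \notin S}.
Definition delete_adj : rel delete_vertex := fun x y => adj (val x) (val y).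

Lemma delete_adj_sym : symmetric delete_adj.
Proof. by move=> x y; apply: adj_sym. Qed.

Lemma delete_adj_irr : irreflexive delete_adj.
Proof. by move=> x; apply: adj_irr. Qed.

Definition delete : sgraph := SGraph delete_adj_sym delete_adj_irr.
End DeleteVertices.

Section LexicographicProduct.
Variables G1 G2 : sgraph.

Definition lex_adj : rel (G1 * G2) := fun u v =>
  adj u.1 v.1 || (u.1 == v.1) && adj u.2 v.2.

Lemma lex_adj_sym : symmetric lex_adj.
Proof.
by move=> u v; rewrite /lex_adj eq_sym (adj_sym u.1) (adj_sym u.2).
Qed.

Lemma lex_adj_irr : irreflexive lex_adj.
Proof. by move=> u; rewrite /lex_adj !adj_irr andbF. Qed.

Definition lex_product : sgraph := SGraph lex_adj_sym lex_adj_irr.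
End LexicographicProduct.

Definition vertex_cut (G : sgraph) (S : {set G}) : bool :=
  ~~ connected (delete S) || (#|delete S| == 1).

Definition k1_vertex_cut (G : sgraph) (S : {set G}) : bool :=
  vertex_cut S && [forall x : delete S, ~~ isolated x].

(* [Some m] is the natural number m and [None] is infinity, the minimum over
   an empty family. *)
Definition min_card (T : finType) (P : pred {set T}) : option nat :=
  if [pick S | P S] is Some S0
  then Some #|[arg min_(S < S0 | P S) #|S|]| else None.

Lemma min_cardP (T : finType) (P : pred {set T}) (m : nat) :
  min_card P = Some m <->
  (exists2 S, P S & #|S| = m) /\ (forall S, P S -> m <= #|S|).
Proof.
rewrite /min_card; case: pickP => [S0 PS0 | P0]; last first.
  by split=> // -[[S PS _] _]; rewrite P0 in PS.
case: arg_minnP => // S PS minS; split=> [[<-] | [[S' PS' <-] minm]].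
  by split=> //; exists S.
by congr Some; apply/eqP; rewrite eqn_leq minS ?minm.
Qed.

Lemma min_card_infty (T : finType) (P : pred {set T}) :
  min_card P = None <-> (forall S, ~~ P S).
Proof.
rewrite /min_card; case: pickP => [S0 PS0 | P0].
  by split=> // /(_ S0); rewrite PS0.
by split=> // _ S; rewrite P0.
Qed.

Definition connectivity (G : sgraph) : option nat := min_card (@vertex_cut G).

Definition k1_connectivity (G : sgraph) : option nat :=
  min_card (@k1_vertex_cut G).

Lemma connectivity_fin (G : sgraph) : 0 < #|G| -> connectivity G <> None.
Proof.
case/card_gt0P=> x _ /min_card_infty /(_ [set~ x]) /negP; apply.
rewrite /vertex_cut; apply/orP; right.
by rewrite card_sig (eq_card (B := pred1 x)) ?card1 // => y; rewrite !inE negbK.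
Qed.

(* Main.v *)
(** Deleting a set [T] of vertices from the product and sending [(x, y)] to [x]
    gives a surjection onto [G1] minus the vertices whose whole fibre lies in
    [T], under which vertices of distinct fibres are adjacent exactly if their
    images are. Such a surjection reflects and, unless the target is a single
    vertex, preserves disconnectedness, and it maps isolated vertices to
    isolated vertices. So unions of fibres over disconnecting sets of [G1] cut
    the product, while every cut of the product contains all fibres over a cut
    of [G1]. Hence the connectivity of the product is [#|G2|] times that of
    [G1], and it is attained over a minimum cut without isolated vertices. *)
Require Import Defs.
From mathcomp Require Import all_boot.

Set Implicit Arguments.
Unset Strict Implicit.
Unset Printing Implicit Defensive.

Section MinCard.
Variables T U : finType.

Lemma min_card_eq_leq (P Q : pred {set T}) (R : {set T}) :
  min_card P = min_card Q -> Q R -> exists2 S, P S & #|S| <= #|R|.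
Proof.
case minQ: (min_card Q) => [m|] minP QR; last first.
  by have /min_card_infty/(_ R)/negP[] := minQ.
have /min_cardP[[S PS cardS] _] := minP; have /min_cardP[_ geQ] := minQ.
by exists S; rewrite ?cardS ?geQ.
Qed.

Lemma min_card_scale (P : pred {set T}) (Q : pred {set U}) (n : nat) :
  (forall S, P S -> exists2 R, Q R & #|R| <= #|S| * n) ->
  (forall R, Q R -> exists2 S, P S & #|S| * n <= #|R|) ->
  min_card Q = omap (muln^~ n) (min_card P).
Proof.
move=> PQ QP; case minP: (min_card P) => [m|] /=; last first.
  apply/min_card_infty => R; apply/negP => /QP[S PS _].
  by have /min_card_infty/(_ S)/negP[] := minP.
have /min_cardP[[S PS cardS] geP] := minP.
have geQ R : Q R -> m * n <= #|R|.
  by case/QP=> S' /geP leS'; apply: leq_trans; rewrite leq_mul2r leS' orbT.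
apply/min_cardP; split=> //; have [R QR leR] := PQ S PS.
by exists R => //; apply/eqP; rewrite eqn_leq geQ // -cardS leR.
Qed.

End MinCard.

Lemma connect_adj_sym (G : sgraph) : connect_sym (@adj G).
Proof. exact/sym_connect_sym/adj_sym. Qed.

Lemma connected_isolated (G : sgraph) (x : G) :
  connected G -> isolated x = (#|G| == 1).
Proof.
move=> /forallP/(_ x)/forallP conn; apply/forallP/eqP => [iso | card1 y].
  have closed_x : closed (@adj G) (pred1 x).
    apply: (intro_closed (@connect_adj_sym G)) => y z yz /eqP y_x.
    by rewrite y_x (negPf (iso z)) in yz.
  apply: (eq_card1 (x := x)) => y.
  by rewrite -(closed_connect closed_x (conn y)) !inE eqxx.
by have /fintype1[z eq_z] := card1; rewrite (eq_z x) (eq_z y) adj_irr.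
Qed.

Section VertexCuts.
Variable G : sgraph.
Implicit Type S : {set G}.

Lemma card_delete S : #|delete S| = #|~: S|.
Proof. by rewrite card_sig; apply: eq_card => x; rewrite !inE. Qed.

Lemma vertex_cut_gt0 S : vertex_cut S -> 0 < #|G|.
Proof.
case/orP=> [/forallPn[x _] | /eqP card1].
  by apply/card_gt0P; exists (val x).
by apply: leq_trans (max_card (~: S)); rewrite -card_delete card1.
Qed.

Lemma connectivity_empty : #|G| = 0 -> connectivity G = None.
Proof.
move=> G0; apply/min_card_infty => S.
by apply/negP => /vertex_cut_gt0; rewrite G0.
Qed.

Lemma k1_connectivity_infty :
  connectivity G = None -> k1_connectivity G = None.
Proof.
move/min_card_infty=> no_cut; apply/min_card_infty => S.
by rewrite /k1_vertex_cut negb_and no_cut.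
Qed.

Lemma k1_vertex_cutE S :
  k1_vertex_cut S =
  ~~ connected (delete S) && [forall x : delete S, ~~ isolated x].
Proof.
rewrite /k1_vertex_cut /vertex_cut; have [conn | //] := boolP (connected _).
apply/negP => /andP[/eqP card1 /forallP no_iso].
have /card_gt0P[x _] : 0 < #|delete S| by rewrite card1.
by have := no_iso x; rewrite connected_isolated // card1.
Qed.

(* If [S] leaves a single vertex, the complement of two nonadjacent vertices
   disconnects [G] and is smaller. *)
Lemma vertex_cut_disconnecting S :
  ~~ complete G -> vertex_cut S ->
  exists2 R : {set G}, ~~ connected (delete R) & #|R| <= #|S|.
Proof.
case/forallPn=> x /forallPn[y]; rewrite negb_imply => /andP[x_neq_y nadj_xy].
case/orP=> [disc | /eqP card1]; first by exists S.
pose R := ~: [set x; y].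
have card2 : #|delete R| = 2 by rewrite card_delete setCK cards2 x_neq_y.
exists R; last first.
  rewrite -(leq_add2r 1) -[in leqRHS]card1 card_delete cardsC -(cardsC R).
  by rewrite leq_add2l -card_delete card2.
have xR : x \notin R by rewrite !inE eqxx.
have iso_x : isolated (Sub x xR : delete R).
  apply/forallP => z; rewrite /= /delete_adj /=.
  by have := valP z; rewrite !inE negbK => /pred2P[]->; rewrite ?adj_irr.
by apply/negP => conn; rewrite connected_isolated // card2 in iso_x.
Qed.

End VertexCuts.

(* The fibres of [f] are modules of [G], and [H] is the quotient graph. *)
Definition modular_quotient (G H : sgraph) (f : G -> H) : Prop :=
  (forall x, exists p, f p = x) /\
  (forall p q, f p != f q -> adj p q = adj (f p) (f q)).

Section ModularQuotient.
Variables (G H : sgraph) (f : G -> H).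
Hypothesis f_quotient : modular_quotient f.

Lemma modular_quotient_adj (p q : G) : adj (f p) (f q) -> adj p q.
Proof.
move=> adj_f; rewrite f_quotient.2 //.
by apply: contraTneq adj_f => ->; rewrite adj_irr.
Qed.

Lemma modular_quotient_isolated (p : G) : isolated p -> isolated (f p).
Proof.
move/forallP=> iso; apply/forallP => y; have [q <-] := f_quotient.1 y.
by apply: contraNN (iso q); apply: modular_quotient_adj.
Qed.

Lemma modular_quotient_connected : connected G -> connected H.
Proof.
move/forallP=> conn; apply/forallP => x; apply/forallP => y.
have [[p <-] [q <-]] := (f_quotient.1 x, f_quotient.1 y).
pose reached := [pred r | connect (@adj H) (f p) (f r)].
have closed_reached : closed (@adj G) reached.
  apply: (intro_closed (@connect_adj_sym G)) => r s rs; rewrite !inE => p_r.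
  have [<- // | r_neq_s] := eqVneq (f r) (f s).
  by apply: connect_trans p_r (connect1 _); rewrite -f_quotient.2.
have /forallP/(_ q) p_q := conn p.
have -> : connect (@adj H) (f p) (f q) = (q \in reached) by [].
by rewrite -(closed_connect closed_reached p_q) inE connect0.
Qed.

(* Two vertices of the same fibre are joined through any fibre adjacent to it;
   there is one as [H] has no isolated vertex. *)
Lemma modular_quotient_lift_connected :
  connected H -> #|H| != 1 -> connected G.
Proof.
move=> conn cardH; apply/forallP => p; apply/forallP => q.
pose reached := [pred x | [forall r, (f r == x) ==> connect (@adj G) p r]].
have closed_reached : closed (@adj H) reached.
  apply: (intro_closed (@connect_adj_sym H)) => x y xy /forallP x_reached.
  have [r fr] := f_quotient.1 x; have := x_reached r; rewrite fr eqxx /= => p_r.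
  apply/forallP => s; apply/implyP => /eqP fs.
  apply: connect_trans p_r (connect1 _).
  by apply: modular_quotient_adj; rewrite fr fs.
have fp_reached : f p \in reached.
  have /forallPn[y] : ~~ isolated (f p) by rewrite connected_isolated.
  have [r <-] := f_quotient.1 y; rewrite negbK => p_r.
  apply/forallP => s; apply/implyP => /eqP fs.
  apply: (@connect_trans _ _ r); apply/connect1/modular_quotient_adj => //.
  by rewrite adj_sym fs.
have /forallP/(_ (f q)) fp_fq := forallP conn (f p).
rewrite (closed_connect closed_reached fp_fq) in fp_reached.
by have /forallP/(_ q) := fp_reached; rewrite eqxx.
Qed.

End ModularQuotient.

Section LexicographicCuts.
Variables G1 G2 : sgraph.
Local Notation L := (lex_product G1 G2).
Implicit Types (S : {set G1}) (T : {set L}).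

Definition fibres S : {set L} := [set p | p.1 \in S].

Definition full_fibres T : {set G1} := [set x | [forall y, (x, y) \in T]].

Lemma card_fibres S : #|fibres S| = #|S| * #|G2|.
Proof.
rewrite -[#|G2|]cardsT -cardsX; apply: eq_card => -[x y].
by rewrite !inE andbT.
Qed.

Lemma fibresK : 0 < #|G2| -> cancel fibres full_fibres.
Proof.
case/card_gt0P=> y _ S; apply/setP => x; rewrite inE.
by apply/forallP/idP => [/(_ y) | xS z]; rewrite inE.
Qed.

Lemma leq_card_full_fibres T : #|full_fibres T| * #|G2| <= #|T|.
Proof.
rewrite -card_fibres; apply/subset_leq_card/subsetP => -[x y].
by rewrite !inE => /forallP.
Qed.

Section Projection.
Variable T : {set L}.

Lemma delete_fst_notin (p : delete T) : (val p).1 \notin full_fibres T.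
Proof.
rewrite inE; apply/forallPn; exists (val p).2.
by rewrite -surjective_pairing (valP p).
Qed.

Definition delete_fst (p : delete T) : delete (full_fibres T) :=
  Sub (val p).1 (delete_fst_notin p).

Lemma delete_fst_quotient : modular_quotient delete_fst.
Proof.
split=> [x | p q].
  have := valP x; rewrite inE => /forallPn[y xy_notin].
  by exists (Sub ((val x, y) : L) xy_notin); apply: val_inj.
rewrite -val_eqE /= /delete_adj /= /lex_adj => /negPf->.
by rewrite orbF.
Qed.

End Projection.

Lemma full_fibres_connected T :
  connected (delete T) -> connected (delete (full_fibres T)).
Proof. exact: modular_quotient_connected (delete_fst_quotient T). Qed.

Lemma fibres_k1_vertex_cut S :
  0 < #|G2| -> k1_vertex_cut S -> k1_vertex_cut (fibres S).
Proof.
move=> G2_gt0; rewrite -{1}[S]fibresK // !k1_vertex_cutE.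
case/andP=> disc /forallP no_iso; apply/andP; split.
  exact: contraNN (@full_fibres_connected _) disc.
apply/forallP => p; apply: contraNN (no_iso (delete_fst p)).
exact/modular_quotient_isolated/delete_fst_quotient.
Qed.

Lemma full_fibres_vertex_cut T :
  vertex_cut T -> vertex_cut (full_fibres T).
Proof.
have quot := delete_fst_quotient T.
apply: contraLR; rewrite /vertex_cut !negb_or !negbK => /andP[conn card_neq1].
have connT := modular_quotient_lift_connected quot conn card_neq1.
rewrite connT /=; apply: contraNN card_neq1 => cardT.
have /card_gt0P[p _] : 0 < #|delete T| by rewrite (eqP cardT).
rewrite -(connected_isolated (delete_fst p) conn).
by apply: (modular_quotient_isolated quot); rewrite connected_isolated.
Qed.

Lemma connectivity_lex_product :
  ~~ complete G1 -> 0 < #|G2| ->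
  connectivity L = omap (muln^~ #|G2|) (connectivity G1).
Proof.
move=> noncomplete G2_gt0; apply: min_card_scale => [S cutS | T cutT].
  have [R disc leR] := vertex_cut_disconnecting noncomplete cutS.
  exists (fibres R); last by rewrite card_fibres leq_mul2r leR orbT.
  apply/orP; left; apply: contraNN disc => /full_fibres_connected.
  by rewrite fibresK.
exists (full_fibres T); last exact: leq_card_full_fibres.
exact: full_fibres_vertex_cut.
Qed.

Lemma k1_connectivity_lex_product :
  k1_connectivity G1 = connectivity G1 -> 0 < #|G2| ->
  k1_connectivity L = omap (muln^~ #|G2|) (k1_connectivity G1).
Proof.
move=> k1G1 G2_gt0; apply: min_card_scale => [S cutS | T /andP[cutT _]].
  by exists (fibres S); rewrite ?fibres_k1_vertex_cut ?card_fibres.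
have [S cutS leS] := min_card_eq_leq k1G1 (full_fibres_vertex_cut cutT).
exists S => //; apply: leq_trans (leq_card_full_fibres T).
by rewrite leq_mul2r leS orbT.
Qed.

End LexicographicCuts.

Theorem theorem2p2 (G1 G2 : sgraph)
  (G1_connected : connected G1) (G1_noncomplete : ~~ complete G1)
  (k1G1 : k1_connectivity G1 = connectivity G1) :
  k1_connectivity (lex_product G1 G2) = connectivity (lex_product G1 G2).
Proof.
have [G2_0 | G2_gt0] := posnP #|G2|.
  have L_infty : connectivity (lex_product G1 G2) = None.
    by apply: connectivity_empty; rewrite card_prod G2_0 muln0.
  by rewrite L_infty k1_connectivity_infty.
by rewrite k1_connectivity_lex_product // connectivity_lex_product // k1G1.
Qed.
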